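(* Let $\delta\in(0,1)$ and $N\geq 1$, and let $g\in\mathbb{F}_2[x_1,\ldots,x_N]$ be a polynomial (viewed as a function $\{0,1\}^N\to\{0,1\}$) that solves the $\delta$-coin problem. Then $\deg(g)=\Omega(1/\delta)$, where the implicit constant is absolute (in particular, independent of $N$).
   Context: For $\alpha\in[0,1]$, $D_\alpha^N$ is the product distribution on $\{0,1\}^N$ in which each bit is independently $1$ with probability $\alpha$. Let $\mu_0^N=D^N_{(1-\delta)/2}$ and $\mu_1^N=D^N_{(1+\delta)/2}$. A function $g:\{0,1\}^N\to\{0,1\}$ solves the $\delta$-coin problem if $\Pr_{x\sim\mu_0^N}[g(x)=1]\leq 0.1$ and $\Pr_{x\sim\mu_1^N}[g(x)=1]\geq 0.9$. *)

(* Defs.v *)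
From mathcomp Require Import all_boot all_order all_algebra.
From mathcomp Require Import reals.
From mathcomp Require Import mpoly.

Set Implicit Arguments.
Unset Strict Implicit.
Unset Printing Implicit Defensive.

Import Order.TTheory GRing.Theory Num.Theory.
Local Open Scope ring_scope.

Definition cube (N : nat) : finType := {ffun 'I_N -> bool}.

Definition bit_weight (R : realType) (alpha : R) (b : bool) : R :=
  if b then alpha else 1 - alpha.

Definition prod_dist (R : realType) (N : nat) (alpha : R) (x : cube N) : R :=
  \prod_(i < N) bit_weight alpha (x i).

Definition Pr_prod_dist (R : realType) (N : nat) (alpha : R)
  (E : pred (cube N)) : R := \sum_(x | E x) prod_dist alpha x.

Definition solves_coin_problem (R : realType) (N : nat) (delta : R)
    (g : cube N -> bool) : Prop :=
  Pr_prod_dist ((1 - delta) / 2) [pred x | g x] <= 1 / 10 /\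
  9 / 10 <= Pr_prod_dist ((1 + delta) / 2) [pred x | g x].

(* As 'F_2 = {0, 1}, the value of p at a Boolean point is either 0 or 1, and
   is identified with the truth value of "p(x) = 1". *)
Definition bool_fun (N : nat) (p : {mpoly 'F_2[N]}) (x : cube N) : bool :=
  p.@[fun i => (x i)%:R] == 1.

(* Total degree: msize is one more than the degree, except that msize 0 = 0,
   so that the zero polynomial gets degree 0 here. *)
Definition total_degree (N : nat) (p : {mpoly 'F_2[N]}) : nat := (msize p).-1.

(* Main.v *)
Require Import Defs.
From mathcomp Require Import all_boot all_order all_algebra.
From mathcomp Require Import reals.
From mathcomp Require Import mpoly.
From mathcomp Require Import polyrcf zify ring lra.

Import Order.TTheory GRing.Theory Num.Theory.
Local Open Scope ring_scope.

Set Implicit Arguments.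
Unset Strict Implicit.
Unset Printing Implicit Defensive.

(* The acceptance probability h(a) = Pr_{D_a}[g = 1] is a real polynomial in a,
   and h increases by at least 0.8 on an interval of length delta, so it is
   enough to show h'(a) = O(deg g).

   Fix M = 2m + 1 and a subset A of an M-element set.  Let each coordinate of x
   independently read the indicator of A at a uniform position with probability
   q, and be a constant bit otherwise, with the constants balanced so that x is
   distributed as D_b, b = a + q (2|A| - M) / (2M).  For a fixed choice of
   positions and constants, g(x) is a polynomial of degree at most deg g over
   F_2 in the indicator of A, so by Smolensky's theorem its correlation with the
   majority function of A (A uniform) is at most deg g * C(M, m) / 2^M.
   Averaged over the choices, this bounds the correlation of h(b) with majority.
   Expanding h around a, that correlation is h'(a) times the normalised first
   absolute moment of |A|, which is of the same order C(2m, m) / 4^m, up to an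
   error O(1 / M).  Letting m tend to infinity gives q h'(a) <= 2 deg g. *)

(** * Polynomials of bounded degree as functions on the subsets of a finite type *)

Section DegreeOnSets.
Variables (T : finType) (F : comNzRingType).
Implicit Types (f g : {set T} -> F) (A S : {set T}).

(** [(S \subset A)%:R] is the multilinear monomial of [S] evaluated at the indicator vector of [A];
    coefficients at sets larger than [k] are ignored. *)
Definition set_poly (k : nat) (c : {set T} -> F) A : F :=
  \sum_(S : {set T} | (#|S| <= k)%N) c S * (S \subset A)%:R.

Definition deg_le (k : nat) f : Prop := exists c, f =1 set_poly k c.

Lemma eq_deg_le k f g : f =1 g -> deg_le k f -> deg_le k g.
Proof. by move=> fg [c fc]; exists c => A; rewrite -fg fc. Qed.

Lemma deg_le_mono k S : (#|S| <= k)%N -> deg_le k (fun A => (S \subset A)%:R).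
Proof.
move=> Sk; exists (fun S' => (S' == S)%:R) => A.
rewrite /set_poly (bigD1 S) //= eqxx mul1r big1 ?addr0 // => S' /andP[_ /negPf->].
by rewrite mul0r.
Qed.

Lemma deg_le_cst k a : deg_le k (fun=> a).
Proof.
exists (fun S => a * (S == set0)%:R) => A.
rewrite /set_poly (bigD1 set0) ?cards0 //= eqxx sub0set !mulr1 big1 ?addr0 //.
by move=> S /andP[_ /negPf->]; rewrite mulr0 mul0r.
Qed.

Lemma deg_leD k f g : deg_le k f -> deg_le k g -> deg_le k (fun A => f A + g A).
Proof.
move=> [c fc] [c' gc]; exists (fun S => c S + c' S) => A.
by rewrite fc gc -big_split; apply: eq_bigr => S _; rewrite mulrDl.
Qed.

Lemma deg_leZ k a f : deg_le k f -> deg_le k (fun A => a * f A).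
Proof.
move=> [c fc]; exists (fun S => a * c S) => A.
by rewrite fc mulr_sumr; apply: eq_bigr => S _; rewrite mulrA.
Qed.

Lemma deg_le_sum (I : Type) (r : seq I) (P : pred I) k (f : I -> {set T} -> F) :
  (forall i, P i -> deg_le k (f i)) ->
  deg_le k (fun A => \sum_(i <- r | P i) f i A).
Proof.
move=> fk; elim: r => [|i r IHr].
  by apply: eq_deg_le (deg_le_cst k 0) => A; rewrite big_nil.
have [Pi|nPi] := boolP (P i).
  by apply: eq_deg_le (deg_leD (fk i Pi) IHr) => A; rewrite big_cons Pi.
by apply: eq_deg_le IHr => A; rewrite big_cons (negPf nPi).
Qed.

(** Variables are idempotent at 0/1 points, so the monomials of [S] and [S'] multiply to that of
    [S :|: S']. *)
Lemma deg_le_mul k l f g :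
  deg_le k f -> deg_le l g -> deg_le (k + l) (fun A => f A * g A).
Proof.
move=> [c fc] [c' gc].
apply: (@eq_deg_le _ (fun A => \sum_(S : {set T} | (#|S| <= k)%N)
   \sum_(S' : {set T} | (#|S'| <= l)%N) c S * c' S' * (S :|: S' \subset A)%:R)).
  move=> A; rewrite fc gc mulr_suml; apply: eq_bigr => S _.
  rewrite mulr_sumr; apply: eq_bigr => S' _.
  by rewrite subUset -mulnb natrM mulrACA.
apply: deg_le_sum => S Sk; apply: deg_le_sum => S' S'l; apply/deg_leZ/deg_le_mono.
exact: leq_trans (leq_card_setU _ _) (leq_add Sk S'l).
Qed.

Lemma deg_le_exp k n f : deg_le k f -> deg_le (n * k) (fun A => f A ^+ n).
Proof.
move=> fk; elim: n => [|n IHn]; first exact: deg_le_cst.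
by apply: eq_deg_le (deg_le_mul fk IHn) => A; rewrite exprS.
Qed.

Lemma deg_le_prod (I : Type) (r : seq I) (P : pred I) (k : I -> nat)
    (f : I -> {set T} -> F) :
  (forall i, P i -> deg_le (k i) (f i)) ->
  deg_le (\sum_(i <- r | P i) k i) (fun A => \prod_(i <- r | P i) f i A).
Proof.
move=> fk; elim: r => [|i r IHr].
  by apply: eq_deg_le (deg_le_cst _ 1) => A; rewrite big_nil.
rewrite big_cons; have [Pi|nPi] := boolP (P i).
  by apply: eq_deg_le (deg_le_mul (fk i Pi) IHr) => A; rewrite big_cons Pi.
by apply: eq_deg_le IHr => A; rewrite big_cons (negPf nPi).
Qed.

Lemma deg_leW k l f : (k <= l)%N -> deg_le k f -> deg_le l f.
Proof.
move=> kl [c fc]; apply: eq_deg_le (fun A => esym (fc A)) _.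
apply: deg_le_sum => S Sk; apply/deg_leZ/deg_le_mono; exact: leq_trans kl.
Qed.

Lemma deg_le_mem (i : T) : deg_le 1 (fun A => (i \in A)%:R).
Proof.
apply: eq_deg_le (@deg_le_mono 1 [set i] _); last by rewrite cards1.
by move=> A; rewrite sub1set.
Qed.

(** Negating the variables turns a monomial into a product of affine factors [1 - x_i], one for each
    element of [S]. *)
Lemma deg_le_setC k f : deg_le k f -> deg_le k (fun A => f (~: A)).
Proof.
move=> [c fc]; apply: eq_deg_le (fun A => esym (fc (~: A))) _.
apply: deg_le_sum => S Sk; apply: deg_leZ.
apply: (@eq_deg_le _ (fun A => \prod_(i in S) (1 + -1 * (i \in A)%:R))).
  move=> A; have [/subsetP SA|/subsetPn[i iS]] := boolP (S \subset ~: A).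
    apply: big1 => i /SA; rewrite inE => /negPf->; by rewrite mulr0 addr0.
  by rewrite inE negbK => iA; rewrite (bigD1 i) //= iA mulr1 subrr mul0r.
apply: (@deg_leW (\sum_(i in S) 1)); first by rewrite sum1_card.
apply: deg_le_prod => i _; apply: deg_leD; first exact: deg_le_cst.
exact/deg_leZ/deg_le_mem.
Qed.

(* Moebius inversion on the Hamming ball of radius k. *)
Lemma set_poly_inj k (c c' : {set T} -> F) :
  (forall A, (#|A| <= k)%N -> set_poly k c A = set_poly k c' A) ->
  forall S, (#|S| <= k)%N -> c S = c' S.
Proof.
move=> cc' S; move: {2}#|S|.+1 (ltnSn #|S|) => n.
elim: n S => // n IHn S; rewrite ltnS => Sn Sk.
have := cc' S Sk; rewrite /set_poly !(bigD1 S Sk) /= subxx !mulr1.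
set X := (\sum_(_ | _) _); set Y := (\sum_(_ | _) _).
suff -> : X = Y by move/addIr.
apply: eq_bigr => S' /andP[S'k S'S].
have [S'sub|_] := boolP (S' \subset S); last by rewrite !mulr0.
rewrite IHn //; apply: leq_trans Sn; apply: proper_card.
by rewrite properEneq S'S.
Qed.

End DegreeOnSets.

Lemma deg_le_meval (T : finType) (F : comNzRingType) (N : nat)
    (p : {mpoly F[N]}) (x : 'I_N -> {set T} -> F) :
  (forall j, deg_le 1 (x j)) ->
  deg_le (msize p).-1 (fun A => p.@[fun j => x j A]).
Proof.
move=> x1.
apply: (@eq_deg_le _ _ _ (fun A => \sum_(m <- msupp p | m \in msupp p)
          p@_m * \prod_j x j A ^+ m j)).
  by move=> A; rewrite mevalE [RHS]big_seq.
apply: deg_le_sum => m mp; apply: deg_leZ.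
apply: (@deg_leW _ _ (\sum_j m j * 1)).
  under eq_bigr do rewrite muln1.
  by rewrite -mdegE -ltnS (leq_trans (msize_mdeg_lt mp)) // leqSpred.
by apply: deg_le_prod => j _; apply: deg_le_exp.
Qed.

(** * Smolensky's bound on the correlation of low-degree polynomials with majority *)

Lemma leq_bin_upper_half m k : ('C((2 * m).+1, (m + k).+1) <= 'C((2 * m).+1, m))%N.
Proof.
elim: k => [|k IHk].
  rewrite addn0 -[X in (X <= _)%N]bin_sub ?ltnS ?leq_pmull //.
  by have -> : ((2 * m).+1 - m.+1 = m)%N by lia.
apply: leq_trans IHk; rewrite addnS.
have := mul_bin_left (2 * m).+1 (m + k).+1.
by move: 'C(_, _) 'C(_, _) => a b; nia.
Qed.

Section Smolensky.
Variables (T : finType) (m : nat).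
Hypothesis cardT : #|T| = (2 * m).+1.

(** As [#|T|] is odd, complementation exchanges the sets of size at most [m] with the larger
    ones. *)
Lemma card_ball_half : (2 * #|[set S : {set T} | (#|S| <= m)%N]| = 2 ^ #|T|)%N.
Proof.
rewrite -(cardsT T) -card_powerset powersetT cardsT -(cardsC [set S : {set T} | (#|S| <= m)%N]).
rewrite mul2n -addnn; congr (_ + _)%N.
rewrite -(card_imset _ (can_inj (@setCK T))); apply: eq_card => S.
rewrite -{1}(setCK S) mem_imset; last exact: (can_inj (@setCK T)).
rewrite !inE cardsCs setCK cardT; lia.
Qed.

Lemma card_ball_le (k : nat) :
  (#|[set S : {set T} | (#|S| <= m + k)%N]| <=
     #|[set S : {set T} | (#|S| <= m)%N]| + k * 'C((2 * m).+1, m))%N.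
Proof.
elim: k => [|k IHk]; first by rewrite addn0 mul0n addn0.
have -> : [set S : {set T} | (#|S| <= m + k.+1)%N] =
          [set S : {set T} | (#|S| <= m + k)%N] :|: [set S : {set T} | #|S| == (m + k).+1].
  by apply/setP=> S; rewrite !inE; lia.
apply: leq_trans (leq_card_setU _ _) _; rewrite card_draws cardT.
rewrite mulSn [X in (_ <= _ + X)%N]addnC addnA leq_add //.
exact: leq_bin_upper_half.
Qed.

Section Agreement.
Variable F : finComNzRingType.
Let maj (A : {set T}) : F := (m < #|A|)%:R.

(* The coefficient families of u and of v in f = u + maj * v (with v written in
   the negated variables) are determined by f, on the lower and upper half of
   the cube respectively; there are as many pairs (u, v) as functions f. *)
Lemma majority_decomposition (f : {set T} -> F) :
  exists2 u : {set T} -> F, deg_le m u &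
  exists2 v : {set T} -> F, deg_le m v & forall A, f A = u A + maj A * v A.
Proof.
pose B := [set S : {set T} | (#|S| <= m)%N].
pose D := [set c : {ffun {set T} -> F} | c \in pffun_on 0 B predT].
pose Phi (c : {ffun {set T} -> F} * {ffun {set T} -> F}) : {ffun {set T} -> F} :=
  [ffun A => set_poly m c.1 A + maj A * set_poly m c.2 (~: A)].
have DP c c' : c \in D -> c' \in D ->
    (forall S : {set T}, (#|S| <= m)%N -> c S = c' S) -> c = c'.
  rewrite !inE => /pffun_onP[/subsetP cB _] /pffun_onP[/subsetP c'B _] cc'.
  apply/ffunP => S; have [/cc'//|mS] := leqP #|S| m.
  have Sout : S \notin B by rewrite inE -ltnNge.
  have /eqP -> : c S == 0 by apply: contraNT Sout => /cB.
  by have /eqP -> : c' S == 0 by apply: contraNT Sout => /c'B.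
have Phi_inj : {in setX D D &, injective Phi}.
  move=> [c d] [c' d'] /setXP[/= cD dD] /setXP[/= c'D d'D] /ffunP E.
  have cc' : c = c'.
    apply: DP => //; apply: set_poly_inj => A Am.
    by have := E A; rewrite !ffunE /maj ltnNge Am /= !mul0r !addr0.
  congr (_, _) => //; apply: DP => //; apply: set_poly_inj => A Am.
  have := E (~: A); rewrite !ffunE /maj /= cc' setCK => /addrI.
  have -> : (m < #|~: A|)%N by have := cardsC A; rewrite cardT; lia.
  by rewrite !mul1r.
have cardD : #|D| = (#|F| ^ #|B|)%N.
  by rewrite cardsE card_pffun_on; congr (_ ^ _)%N.
have /eqP imPhi : Phi @: setX D D == [set: {ffun {set T} -> F}].
  rewrite eqEcard subsetT /= card_in_imset // cardsX cardD -expnD addnn -mul2n.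
  by rewrite card_ball_half cardsT card_ffun -(cardsT {set T}) -powersetT card_powerset cardsT.
have /imsetP[[c d] _ /ffunP fE] : finfun f \in Phi @: setX D D.
  by rewrite imPhi inE.
exists (set_poly m c); first by exists c.
exists (fun A => set_poly m d (~: A)).
  by apply: deg_le_setC; exists d.
by move=> A; have := fE A; rewrite !ffunE.
Qed.

(** Where [f] agrees with majority, [maj] can be replaced by [f] in the decomposition [u + maj * v].
    Hence every function on the agreement set [X] is the restriction of a polynomial of degree
    [m + d], and counting functions against coefficient families compares [#|X|] with the size of
    the ball. *)
Lemma card_agree_majority d (f : {set T} -> F) : deg_le d f ->
  (#|[set A | f A == maj A]| <= #|[set S : {set T} | (#|S| <= m + d)%N]|)%N.
Proof.
move=> fd; set X := [set A | _]; set B := [set S | _].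
rewrite -(leq_exp2l _ _ (card_finNzRing_gt1 F)).
pose Psi (c : {ffun {set T} -> F}) : {ffun {set T} -> F} :=
  [ffun A => if A \in X then set_poly (m + d) c A else 0].
have cardE (Y : {set {set T}}) : (#|F| ^ #|Y| = #|pffun_on (0%R : F) Y predT|)%N.
  by rewrite card_pffun_on.
rewrite !cardE; apply: leq_trans (leq_imset_card Psi _).
apply/subset_leq_card/subsetP => h /pffun_onP[/subsetP hX _].
have [u um [v vm huv]] := majority_decomposition h.
have [c cE] : deg_le (m + d) (fun A => u A + v A * f A).
  by apply: deg_leD; [apply: deg_leW um; exact: leq_addr|exact: deg_le_mul].
apply/imsetP; exists [ffun S => if S \in B then c S else 0].
  apply/pffun_onP; split=> //; apply/subsetP=> S.
  by rewrite inE ffunE; case: ifP; rewrite ?eqxx.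
apply/ffunP => A; rewrite ffunE; case: ifPn => AX; last first.
  by apply/eqP; apply: contraNT AX => /hX.
have -> : h A = u A + v A * f A.
  by rewrite huv mulrC; move: AX; rewrite inE => /eqP->.
rewrite cE; apply: eq_bigr => S Sd.
by rewrite ffunE inE Sd.
Qed.

End Agreement.

End Smolensky.

Definition maj_sign (R : pzRingType) (T : finType) (m : nat) (A : {set T}) : R :=
  if (m < #|A|)%N then 1 else -1.

Lemma sum_maj_sign (R : pzRingType) (T : finType) m : #|T| = (2 * m).+1 ->
  \sum_(A : {set T}) maj_sign R m A = 0.
Proof.
move=> cardT.
have E (A : {set T}) : maj_sign R m A = 1 - (A \in [set S : {set T} | (#|S| <= m)%N])%:R *+ 2.
  rewrite inE /maj_sign; case: ltnP => _; first by rewrite mul0rn subr0.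
  by rewrite mulr2n opprD addrA subrr add0r.
rewrite (eq_bigr _ (fun A _ => E A)) big_split /= sumr_const sumrN sumrMnl.
rewrite -natr_sum -big_mkcond sum1_card -mulrnA.
have -> : #|{: {set T}}| = (2 ^ #|T|)%N.
  by rewrite -(cardsT {set T}) -powersetT card_powerset cardsT.
by rewrite -(card_ball_half cardT) mulnC subrr.
Qed.

Lemma F2_eq0 (a : 'F_2) : (a == 0) = (a != 1).
Proof. by case: a => [[|[|[]]]]. Qed.

Lemma majority_correlation (R : numDomainType) (T : finType) m d (f : {set T} -> 'F_2) :
  #|T| = (2 * m).+1 -> deg_le d f ->
  \sum_(A : {set T}) maj_sign R m A * (f A == 1)%:R <= (d * 'C((2 * m).+1, m))%:R.
Proof.
move=> cardT fd.
pose X := [set A | f A == (m < #|A|)%:R]; pose B := [set S : {set T} | (#|S| <= m)%N].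
(* Above the middle [A] is not in [B] and agreement means [f A = 1]; below it agreement means
   [f A = 0], and [-[f A = 1] = [f A = 0] - 1]. *)
have E (A : {set T}) : maj_sign R m A * (f A == 1)%:R = (A \in X)%:R - (A \in B)%:R.
  rewrite !inE /maj_sign; case: ltnP => _; first by rewrite mul1r subr0.
  by rewrite F2_eq0; case: (f A == 1); rewrite /= ?mulr1 ?mulr0 ?subrr ?sub0r.
rewrite (eq_bigr _ (fun A _ => E A)) big_split /= sumrN -!natr_sum -!big_mkcond !sum1_card.
rewrite lerBlDl -natrD ler_nat.
exact: leq_trans (card_agree_majority cardT fd) (card_ball_le cardT d).
Qed.

(** * Moments of the binomial distribution and estimates of central binomial coefficients *)

Section BinomialMoments.
Variable R : realFieldType.
Implicit Types (phi : nat -> R).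

Lemma sum_sets_card phi M :
  \sum_(A : {set 'I_M}) phi #|A| = \sum_(w < M.+1) 'C(M, w)%:R * phi w.
Proof.
rewrite (partition_big (fun A : {set 'I_M} => inord #|A| : 'I_M.+1) predT) //=.
apply: eq_bigr => w _.
have E (A : {set 'I_M}) : (inord #|A| == w) = (#|A| == w).
  by rewrite -val_eqE /= inordK // ltnS -[X in (_ <= X)%N]card_ord max_card.
rewrite (eq_bigl _ _ E) (eq_bigr (fun=> phi w)) => [|A /eqP-> //].
by rewrite sumr_const -[M in 'C(M, _)]card_ord -card_draws cardsE mulr_natl.
Qed.

Lemma sum_bin_pascal phi M :
  \sum_(w < M.+2) 'C(M.+1, w)%:R * phi w =
  \sum_(w < M.+1) 'C(M, w)%:R * (phi w + phi w.+1).
Proof.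
rewrite big_ord_recl bin0 mul1r.
under [X in _ + X]eq_bigr => w _ do rewrite lift0 binS natrD mulrDl.
under [RHS]eq_bigr => w _ do rewrite mulrDr.
rewrite !big_split /= addrA; congr (_ + _).
transitivity (\sum_(w < M.+2) 'C(M, w)%:R * phi w).
  by rewrite [RHS]big_ord_recl bin0 mul1r; congr (_ + _); apply: eq_bigr.
by rewrite big_ord_recr /= bin_small // mul0r addr0.
Qed.

Lemma sum_bin M : \sum_(w < M.+1) 'C(M, w)%:R = 2 ^+ M :> R.
Proof.
have := exprDn (1 : R) 1 M; rewrite -mulr2n => ->.
by apply: eq_bigr => w _; rewrite !expr1n mulr1.
Qed.

Lemma bin_second_moment M :
  \sum_(w < M.+1) 'C(M, w)%:R * (2 * w%:R - M%:R) ^+ 2 = M%:R * 2 ^+ M :> R.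
Proof.
elim: M => [|M IHM]; first by rewrite big_ord1 /=; ring.
rewrite (sum_bin_pascal (fun w => (2 * w%:R - M.+1%:R) ^+ 2)).
(* With [x = 2 w - M] this is [(x - 1)^2 + (x + 1)^2 = 2 x^2 + 2]. *)
transitivity (\sum_(w < M.+1) (2 * ('C(M, w)%:R * (2 * w%:R - M%:R) ^+ 2) + 2 * 'C(M, w)%:R) : R).
  by apply: eq_bigr => w _; rewrite -!natr1; ring.
by rewrite big_split -!mulr_sumr IHM /= sum_bin exprS -natr1; ring.
Qed.

Lemma bin_abs_moment m :
  \sum_(w < (2 * m).+2) 'C((2 * m).+1, w)%:R *
     ((if (m < w)%N then 1 else -1) * (2 * w%:R - (2 * m).+1%:R)) =
  2 * (2 * m).+1%:R * 'C(2 * m, m)%:R :> R.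
Proof.
(* [G] makes the unsigned sum telescope. It vanishes at both ends, and the sign change at the middle
   leaves [G m.+1] twice. *)
pose G w : R := (2 * m).+1%:R * (if w is w'.+1 then 'C(2 * m, w')%:R else 0).
have GE w : (w < (2 * m).+2)%N ->
    'C((2 * m).+1, w)%:R * (2 * w%:R - (2 * m).+1%:R) = G w - G w.+1.
  move=> wm; rewrite /G.
  have := mul_bin_down (2 * m).+1 w; move/(congr1 (fun n => n%:R : R)).
  rewrite !natrM natrB //= => ->.
  case: w wm => [|w] wm; first by rewrite mulr0 mulr0n; ring.
  have := mul_bin_diag (2 * m).+1 w; move/(congr1 (fun n => n%:R : R)).
  by rewrite !natrM /= => ->; ring.
rewrite -(big_mkord predT (fun w => 'C((2 * m).+1, w)%:R *
     ((if (m < w)%N then 1 else -1) * (2 * w%:R - (2 * m).+1%:R)))).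
rewrite (@big_cat_nat _ _ _ m.+1) //=; last by lia.
have -> : \sum_(0 <= i < m.+1) 'C((2 * m).+1, i)%:R *
     ((if (m < i)%N then 1 else -1) * (2 * i%:R - (2 * m).+1%:R)) =
     \sum_(0 <= i < m.+1) (G i.+1 - G i).
  apply: eq_big_nat => i /andP[_ im]; have -> : (m < i)%N = false by lia.
  by rewrite mulrCA GE ?mulN1r ?opprB //; lia.
have -> : \sum_(m.+1 <= i < (2 * m).+2) 'C((2 * m).+1, i)%:R *
     ((if (m < i)%N then 1 else -1) * (2 * i%:R - (2 * m).+1%:R)) =
     - \sum_(m.+1 <= i < (2 * m).+2) (G i.+1 - G i).
  rewrite -sumrN; apply: eq_big_nat => i /andP[im iM].
  by rewrite im mul1r GE ?opprB.
rewrite !telescope_sumr //; last by lia.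
by rewrite /G (bin_small (ltnSn (2 * m))); ring.
Qed.

End BinomialMoments.

(** A square-root-free form of [(2m + 1) C(2m, m) >= sqrt(m + 1) 4^m]. *)
Lemma central_bin_lower m :
  (m.+1 * 16 ^ m <= ((2 * m).+1 * 'C(2 * m, m)) ^ 2)%N.
Proof.
elim: m => // m IHm.
have E : (m.+1 * 'C(2 * m.+1, m.+1) = 2 * ((2 * m).+1 * 'C(2 * m, m)))%N.
  have -> : (2 * m.+1 = (2 * m).+2)%N by lia.
  rewrite -mul_bin_diag /=.
  have := mul_bin_down (2 * m).+1 m; rewrite /=.
  have -> : ((2 * m).+1 - m = m.+1)%N by lia.
  by move=> ->; lia.
rewrite -(@leq_pmul2l (m.+1 ^ 2)) // -expnMn.
rewrite [X in (_ <= X ^ 2)%N]mulnCA E (expnS 16); move: IHm.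
move: ((2 * m).+1 * _)%N (16 ^ m)%N => Z P IHm.
apply: (@leq_trans (4 * (2 * m.+1).+1 ^ 2 * (m.+1 * P))); last first.
  by rewrite !expnMn; move: (Z ^ 2)%N IHm => Q; nia.
(* The slack comes from [(2m + 3)^2 = 4 (m + 1) (m + 2) + 1]. *)
have -> : (4 * (2 * m.+1).+1 ^ 2 * (m.+1 * P) =
           m.+1 ^ 2 * (m.+2 * (16 * P)) + 4 * m.+1 * P)%N.
  by rewrite -!mulnn; ring.
exact: leq_addr.
Qed.

Lemma bin_central_succ m : ('C((2 * m).+1, m) <= 2 * 'C(2 * m, m))%N.
Proof.
have := mul_bin_down (2 * m).+1 m; rewrite /=.
have -> : ((2 * m).+1 - m = m.+1)%N by lia.
by move: 'C(_, _) 'C(_, _) => a b; nia.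
Qed.

(** * From correlation with majority to a bound on the derivative *)

Lemma poly_taylor2 (R : realFieldType) (p : {poly R}) (x : R) :
  exists B : R, forall t, `|t| <= 1 ->
    `|p.[x + t] - p.[x] - p^`().[x] * t| <= B * t ^+ 2.
Proof.
exists (\sum_(i < size p) `|p^`N(i.+2).[x]|) => t t1.
rewrite (@nderiv_taylor_wide _ (size p).+2) //; [|exact: mulrC|by lia].
rewrite 2!big_ord_recl !lift0 [nat_of_ord ord0]/= poly.nderivn0 poly.nderivn1 expr0 mulr1 expr1.
set S := \sum_(i < _) _; have -> : p.[x] + (p^`().[x] * t + S) - p.[x] - p^`().[x] * t = S by ring.
rewrite (le_trans (ler_norm_sum _ _ _)) // mulr_suml ler_sum // => i _.
rewrite normrM ler_wpM2l // !lift0 normrX -[i.+2]addn2 exprD -[t ^+ 2]ger0_norm ?sqr_ge0 //.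
by rewrite normrX ler_piMl ?exprn_ge0 ?exprn_ile1.
Qed.

(** The Archimedean property stands in for the limit in [m]. *)
Lemma sqr_mul_nat_bounded_eq0 (R : realType) (e B : R) :
  (forall m : nat, e ^+ 2 * m%:R <= B) -> e = 0.
Proof.
move=> eB; apply/eqP/negPn/negP => e0.
have e2 : 0 < e ^+ 2 by rewrite exprn_even_gt0.
have B0 : 0 <= B by have := eB 0; rewrite mulr0.
have := archi_boundP (divr_ge0 B0 (ltW e2)).
by rewrite ltr_pdivrMr // mulrC ltNge eB.
Qed.

Lemma deriv_le_of_majority (R : realType) (p : {poly R}) (a q : R) (d : nat) :
  0 <= q <= 1 ->
  (forall m : nat, \sum_(A : {set 'I_(2 * m).+1})
     maj_sign R m A * p.[a + q * (2 * #|A|%:R - (2 * m).+1%:R) / (2 * (2 * m).+1%:R)]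
       <= (d * 'C((2 * m).+1, m))%:R) ->
  q * p^`().[a] <= 2 * d%:R.
Proof.
move=> /andP[q0 q1] ub; have [B taylorB] := poly_taylor2 p a.
rewrite leNgt; apply/negP => gt2d.
(* The excess [e] over the claimed bound will satisfy [e^2 m <= B^2] for every [m], with [B] the
   Taylor constant. *)
pose e := q * p^`().[a] - 2 * d%:R; have e0 : 0 < e by rewrite subr_gt0.
suff E0 : e = 0 by rewrite E0 ltxx in e0.
apply: (@sqr_mul_nat_bounded_eq0 _ _ (B ^+ 2)) => m.
pose M : R := (2 * m).+1%:R; have M0 : 0 < M by rewrite ltr0n.
pose t (w : nat) : R := q * (2 * w%:R - M) / (2 * M).
pose C : R := 'C(2 * m, m)%:R.
have t1 (A : {set 'I_(2 * m).+1}) : `|t #|A| | <= 1.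
  have AM : #|A|%:R <= M by rewrite ler_nat -[X in (_ <= X)%N]card_ord max_card.
  have A0 : 0 <= #|A|%:R :> R by [].
  rewrite /t normrM normfV normrM (ger0_norm q0) (gtr0_norm (mulr_gt0 _ M0)) //.
  rewrite ler_pdivrMr ?mulr_gt0 // mul1r.
  have : `|2 * #|A|%:R - M| <= M by rewrite ler_norml; apply/andP; split; lra.
  move: `|_| (normr_ge0 (2 * #|A|%:R - M)) => y y0 yM; nra.
(* The Taylor error is bounded in absolute value, so the estimate holds for either sign. *)
have lb (A : {set 'I_(2 * m).+1}) :
    maj_sign R m A * p.[a] + p^`().[a] * (maj_sign R m A * t #|A|) - B * t #|A| ^+ 2
    <= maj_sign R m A * p.[a + t #|A|].
  have := taylorB _ (t1 A); rewrite ler_norml => /andP[lo hi].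
  rewrite /maj_sign; case: ifP => _; lra.
have first_moment : \sum_(A : {set 'I_(2 * m).+1}) maj_sign R m A * t #|A| = q * C.
  rewrite (sum_sets_card (fun w => (if (m < w)%N then 1 else -1) * t w)).
  transitivity (q / (2 * M) * (2 * M * C)); last by field; lra.
  rewrite -bin_abs_moment mulr_sumr; apply: eq_bigr => w _; rewrite /t -/M.
  by case: ifP => _; ring.
have second_moment : \sum_(A : {set 'I_(2 * m).+1}) t #|A| ^+ 2 = q ^+ 2 * 4 ^+ m / (2 * M).
  rewrite (sum_sets_card (fun w => t w ^+ 2)).
  transitivity (q ^+ 2 / (2 * M) ^+ 2 * (M * 2 ^+ (2 * m).+1)).
    rewrite -bin_second_moment mulr_sumr; apply: eq_bigr => w _; rewrite /t -/M.
    by field; lra.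
  have -> : 2 ^+ (2 * m).+1 = 2 * 4 ^+ m :> R by rewrite exprS exprM -natrX.
  by field; lra.
have := le_trans (ler_sum _ (fun A _ => lb A)) (ub m).
rewrite !big_split /= sumrN -!mulr_sumr -mulr_suml sum_maj_sign ?card_ord //.
rewrite first_moment second_moment mul0r add0r => main.
have C2 : (d * 'C((2 * m).+1, m))%:R <= d%:R * (2 * C).
  by rewrite natrM ler_wpM2l // -natrM ler_nat bin_central_succ.
have eC : e * (M * C) <= `|B| * 4 ^+ m.
  have : e * C <= B * (q ^+ 2 * 4 ^+ m / (2 * M)).
    have := le_trans main C2; rewrite lerBlDr -lerBlDl => /(le_trans _); apply.
    by rewrite le_eqVlt; apply/orP; left; apply/eqP; rewrite /e; ring.
  rewrite [e * (M * C)]mulrCA -(ler_pM2l M0) => /le_trans; apply.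
  have -> : M * (B * (q ^+ 2 * 4 ^+ m / (2 * M))) = B * (q ^+ 2 / 2) * 4 ^+ m.
    by field; lra.
  rewrite ler_pM2r ?exprn_gt0 //.
  have s0 : 0 <= q ^+ 2 / 2 by rewrite divr_ge0 ?sqr_ge0.
  have s1 : q ^+ 2 / 2 <= 1 by nra.
  apply: le_trans (ler_wpM2r s0 (ler_norm B)) _.
  by rewrite ler_piMr.
(* [M * C] exceeds [4^m] by a factor of at least [sqrt(m + 1)], while [eC] bounds [e * (M * C)] by a
   constant times [4^m]. *)
have MC : m.+1%:R * 16 ^+ m <= (M * C) ^+ 2.
  by rewrite -!natrM -!natrX -natrM ler_nat central_bin_lower.
have eC2 : (e * (M * C)) ^+ 2 <= (`|B| * 4 ^+ m) ^+ 2.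
  rewrite ler_pXn2r // nnegrE ?mulr_ge0 ?exprn_ge0 // ?ltW // mulr_ge0 //.
have P16 : (4 ^+ m) ^+ 2 = 16 ^+ m :> R by rewrite exprAC -natrX.
have P0 : 0 < 16 ^+ m :> R by rewrite exprn_gt0.
rewrite !exprMn P16 real_normK ?num_real // in eC2.
rewrite -(ler_pM2r P0); apply: le_trans eC2; rewrite -exprMn -mulrA.
rewrite ler_wpM2l ?sqr_ge0 //; apply: le_trans MC.
by rewrite ler_pM2r // ler_nat.
Qed.

(** * Product distributions obtained by independent sampling of the coordinates *)

Lemma Pr_prod_dist_sample (R : realType) (N : nat) (I : finType) (wt : I -> R)
    (e : I -> bool) (b : R) (E : pred (cube N)) :
  (forall c, \sum_(i | e i == c) wt i = bit_weight b c) ->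
  Pr_prod_dist b E = \sum_(r : {ffun 'I_N -> I})
    (\prod_j wt (r j)) * (E [ffun j => e (r j)])%:R.
Proof.
move=> wtE; rewrite (partition_big (fun r : {ffun 'I_N -> I} => [ffun j => e (r j)] : cube N) predT) //=.
rewrite /Pr_prod_dist big_mkcond; apply: eq_bigr => x _.
transitivity (prod_dist b x * (E x)%:R).
  by case: (E x); rewrite ?mulr1 ?mulr0.
rewrite /prod_dist (eq_bigr _ (fun j _ => esym (wtE (x j)))).
(* Distributing the product over the sums gives a sum over the seed vectors [r] that produce [x]. *)
rewrite (bigA_distr_big_dep (fun j i => e i == x j) (fun _ => wt)) mulr_suml.
apply: eq_big => [r|r /familyP rx].
  apply/familyP/eqP => [rx|<- j]; last by rewrite ffunE; exact: eqxx.
  by apply/ffunP => j; rewrite ffunE; apply/eqP/rx.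
by congr (_ * (E _)%:R); apply/ffunP => j; rewrite ffunE; apply/esym/eqP/rx.
Qed.

(** The bias is the indeterminate, so that the acceptance probability can be differentiated. *)
Definition Pr_poly (R : realType) (N : nat) (E : pred (cube N)) : {poly R} :=
  \sum_(x | E x) \prod_(i < N) (if x i then 'X else 1 - 'X).

Lemma horner_Pr_poly (R : realType) (N : nat) (E : pred (cube N)) (b : R) :
  (Pr_poly R E).[b] = Pr_prod_dist b E.
Proof.
rewrite horner_sum; apply: eq_bigr => x _; rewrite horner_prod.
by apply: eq_bigr => i _; case: (x i); rewrite !hornerE.
Qed.

Section Sampling.
Variables (R : realType) (M : nat) (a q : R).
Hypothesis M0 : (0 < M)%N.

(* A coordinate of the sample reads a uniform position of A with probability q,
   and is otherwise a constant bit. *)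
Definition sample_weight (s : 'I_M + bool) : R :=
  match s with
  | inl _ => q / M%:R
  | inr true => a - q / 2
  | inr false => 1 - a - q / 2
  end.

Definition sample_bit (A : {set 'I_M}) (s : 'I_M + bool) : bool :=
  match s with inl i => i \in A | inr b => b end.

Lemma sum_sample_weight (A : {set 'I_M}) (c : bool) :
  \sum_(s | sample_bit A s == c) sample_weight s =
  bit_weight (a + q * (2 * #|A|%:R - M%:R) / (2 * M%:R)) c.
Proof.
have Mn0 : M%:R != 0 :> R by rewrite pnatr_eq0 -lt0n.
rewrite big_sumType /= sumr_const [X in _ + X]big_mkcond big_bool /=.
case: c => /=.
  have -> : #|[pred i | (i \in A) == true]| = #|A| by apply: eq_card => i; rewrite !inE eqb_id.
  by rewrite -mulr_natr; field.
have -> : #|[pred i | (i \in A) == false]| = #|~: A| by apply: eq_card => i; rewrite !inE eqbF_neg.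
have -> : #|~: A| = (M - #|A|)%N by have := cardsC A; rewrite card_ord; lia.
rewrite -[_ *+ (M - _)]mulr_natr natrB; last by rewrite -[X in (_ <= X)%N]card_ord max_card.
by field.
Qed.

Lemma sum_sample_weight1 : \sum_s sample_weight s = 1.
Proof.
rewrite (bigID (fun s => sample_bit set0 s == true)) /=.
rewrite [X in _ + X](eq_bigl (fun s => sample_bit set0 s == false)); last first.
  by move=> s; rewrite eqb_id eqbF_neg.
by rewrite !sum_sample_weight /=; ring.
Qed.

End Sampling.

(** The bounds on [a] and [q] make all sample weights nonnegative, so the majority bound for each
    fixed seed vector [r] can be averaged. *)
Lemma Pr_poly_deriv_le (R : realType) (N : nat) (g : {mpoly 'F_2[N]}) (a q : R) :
  0 <= q <= 1 -> q / 2 <= a -> a <= 1 - q / 2 ->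
  q * (Pr_poly R (bool_fun g))^`().[a] <= 2 * (total_degree g)%:R.
Proof.
move=> q01 qa aq; apply: deriv_le_of_majority => // m.
set M := (2 * m).+1; set d := total_degree g.
pose W (r : {ffun 'I_N -> 'I_M + bool}) : R := \prod_j sample_weight a q (r j).
pose f (r : {ffun 'I_N -> 'I_M + bool}) (A : {set 'I_M}) : 'F_2 :=
  g.@[fun j => ([ffun j => sample_bit A (r j)] j)%:R].
have W0 r : 0 <= W r.
  have [q0 q1] := andP q01; apply: prodr_ge0 => j _.
  case: (r j) => [i|[]] /=; first by rewrite divr_ge0.
    by rewrite subr_ge0.
  by lra.
have W1 : \sum_r W r = 1.
  rewrite /W -(bigA_distr_bigA (fun _ => sample_weight a q)) big1 // => j _.
  exact: sum_sample_weight1.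
have fd r : deg_le d (f r).
  apply: deg_le_meval => j; case E : (r j) => [i|b].
    by apply: eq_deg_le (deg_le_mem _ i) => A; rewrite ffunE E.
  by apply: eq_deg_le (deg_le_cst _ _ b%:R) => A; rewrite ffunE E.
rewrite (eq_bigr (fun A : {set 'I_M} =>
    \sum_r W r * (maj_sign R m A * (f r A == 1)%:R))); last first.
  move=> A _; rewrite horner_Pr_poly (Pr_prod_dist_sample _ (sum_sample_weight a q _ A)) //.
  by rewrite mulr_sumr; apply: eq_bigr => r _; rewrite mulrCA.
have -> : (d * 'C(M, m))%:R = \sum_r W r * (d * 'C(M, m))%:R.
  by rewrite -mulr_suml W1 mul1r.
rewrite exchange_big ler_sum //= => r _.
rewrite -mulr_sumr ler_wpM2l //; apply: majority_correlation => //.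
exact: card_ord.
Qed.

Theorem theorem7p2 (R : realType) :
  exists2 c : R, 0 < c &
    forall (delta : R) (N : nat) (g : {mpoly 'F_2[N]}),
      0 < delta < 1 -> (1 <= N)%N ->
      solves_coin_problem delta (bool_fun g) ->
      c * (1 / delta) <= (total_degree g)%:R.
Proof.
(* Taking [q = 1 / 2] gives a slope of at most [4 deg g], while the mean slope is at least
   [0.8 / delta]; their ratio is [1 / 5]. *)
exists (1 / 5) => [|delta N g /andP[d0 d1] _ [lo hi]]; first by rewrite divr_gt0.
pose h := Pr_poly R (bool_fun g).
have lt_ab : (1 - delta) / 2 < (1 + delta) / 2 by lra.
have [x] := poly_mvt h lt_ab; rewrite in_itv /= => /andP[ax xb].
rewrite !horner_Pr_poly.
have -> : (1 + delta) / 2 - (1 - delta) / 2 = delta by field.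
move=> slope; have slope_ge : 8 / 10 <= h^`().[x] * delta by rewrite -slope; lra.
rewrite mulrA mulr1 ler_pdivrMr //.
(* For [delta <= 1 / 2] the point [x] lies in [[1/4, 3/4]], where [q = 1 / 2] is admissible. For
   larger [delta] it is enough that the degree is positive. *)
have [d2|d2] := leP delta (1 / 2).
  have := @Pr_poly_deriv_le R N g x (1 / 2); rewrite -/h => bound.
  have {}bound : 1 / 2 * h^`().[x] <= 2 * (total_degree g)%:R by apply: bound; lra.
  by move: bound slope_ge; set y := h^`().[x]; nra.
have [dg0|dg1] := posnP (total_degree g).
  (* This [q] is admissible on the whole interval; degree 0 would force a nonpositive slope. *)
  have := @Pr_poly_deriv_le R N g x (1 - delta); rewrite -/h dg0 => bound.
  have {}bound : (1 - delta) * h^`().[x] <= 2 * 0%:R by apply: bound; lra.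
  by move: bound slope_ge; set y := h^`().[x]; nra.
have : 1 <= (total_degree g)%:R :> R by rewrite ler1n.
by nra.
Qed.
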